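(* Let $p$ be a prime, $k\geq 1$, and let $G=(V,E)$ be a connected graph with vertices ordered $v_1,\dots,v_n$ and edge-labeling $\alpha:E\to\{\text{ideals of }\mathbb{Z}/p^k\mathbb{Z}\}$. Define sets $\mathbb{B}_{p^\beta}$ for $1\le\beta\le k$ recursively by: $\mathbb{B}_p=\{\mathbf{b}^{(i,1)} : i\in I_1\}$, and for $2\leq\beta\leq k$, \[\mathbb{B}_{p^\beta}=\overline{\mathbb{B}}_{p^{\beta-1}}\cup\{\mathbf{b}^{(i,\beta)} : i\in I_\beta\setminus I_{\beta-1}\}.\] Then for each $1\le\beta\le k$, $\mathbb{B}_{p^\beta}$ is a flow-up minimum generating set for the ring of splines $[\mathbb{Z}/p^\beta\mathbb{Z}]_{G,\alpha_\beta}$.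
   Context: For a commutative ring $R$, a finite connected graph $G=(V,E)$ and an edge-labeling $\alpha$ assigning to each edge an ideal of $R$, a spline on $(G,\alpha)$ is a vertex-labeling $\mathbf{f}\in R^{|V|}$ with $\mathbf{f}_u-\mathbf{f}_v\in\alpha(uv)$ for every edge $uv$; the splines form a ring $R_{G,\alpha}$ under entrywise operations. For $1\le\beta\le k$, $\rho_\beta:\mathbb{Z}/p^k\mathbb{Z}\to\mathbb{Z}/p^\beta\mathbb{Z}$ is the quotient map and $\alpha_\beta(uv)=\rho_\beta(\alpha(uv))$. A zero-connected component of $(G,\alpha_\beta)$ is an equivalence class of vertices under: $u\sim w$ iff joined by a path of edges whose $\alpha_\beta$-label is the zero ideal. $V^{(i,\beta)}$ denotes the zero-connected component of $(G,\alpha_\beta)$ whose smallest-index vertex is $v_i$, and $I_\beta$ is the set of indices $i$ for which $V^{(i,\beta)}$ is defined (i.e., $v_i$ is the smallest-index vertex of a zero-connected component of $(G,\alpha_\beta)$). $\mathbf{b}^{(i,\beta)}\in(\mathbb{Z}/p^\beta\mathbb{Z})^{|V|}$ is the vertex-labeling with value $p^{\beta-1}$ on $V^{(i,\beta)}$ and $0$ elsewhere. For a set $\mathbb{B}$ of splines over $\mathbb{Z}/p^{\beta-1}\mathbb{Z}$, $\overline{\mathbb{B}}$ is the set of vertex-labelings over $\mathbb{Z}/p^\beta\mathbb{Z}$ obtained by replacing each entry by the element of $\mathbb{Z}/p^\beta\mathbb{Z}$ with the same minimal nonnegative integer representative. With vertices ordered, a flow-up spline for $v_i$ is a spline $\mathbf{f}$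 with $\mathbf{f}_{v_t}=0$ for $t<i$; a flow-up generating set consists of flow-up splines. A minimum generating set is a generating set with the smallest possible number of elements. *)

(* Defs.v *)
From HB Require Import structures.
From mathcomp Require Import all_boot all_order all_algebra.
Set Implicit Arguments.
Unset Strict Implicit.
Unset Printing Implicit Defensive.
Import GRing.Theory.
Local Open Scope ring_scope.

(* The vertices v_1, ..., v_n are the elements 0, ..., n-1 of 'I_n, in that
   order.  An edge uv is the two-element set [set u; v]. *)
Definition simple_graph n (E : {set {set 'I_n}}) : Prop :=
  forall e, e \in E -> #|e| = 2%N.

Definition connected_graph n (E : {set {set 'I_n}}) : Prop :=
  (0 < n)%N /\ forall u v, connect [rel x y | [set x; y] \in E] u v.

(* The idealr structure of ring_quotient only covers proper ideals, whereas
   edge labels may be the whole ring. *)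
Definition is_ideal (R : finComNzRingType) (I : {set R}) : Prop :=
  0 \in I /\ forall a, {in I &, forall x y, a * x + y \in I}.

(* Only the values of a labeling on the edges matter. *)
Definition ideal_labeling (R : finComNzRingType) n (E : {set {set 'I_n}})
    (alpha : {set 'I_n} -> {set R}) : Prop :=
  forall e, e \in E -> is_ideal (alpha e).

Definition splines (R : finComNzRingType) n (E : {set {set 'I_n}})
    (alpha : {set 'I_n} -> {set R}) : {set {ffun 'I_n -> R}} :=
  [set f : {ffun 'I_n -> R} | [forall u, forall v,
    ([set u; v] \in E) ==> (f u - f v \in alpha [set u; v])]].

(* Generation is meant as an R-module: for R = Z/p the splines b^(i,1) are
   idempotents, and fewer of them can suffice to generate the R-algebra. *)
Definition generating_set (R : finComNzRingType) n
    (M B : {set {ffun 'I_n -> R}}) : Prop :=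
  B \subset M /\
  forall f, f \in M -> exists c : {ffun 'I_n -> R} -> R,
    forall u, f u = \sum_(b in B) c b * b u.

Definition minimum_generating_set (R : finComNzRingType) n
    (M B : {set {ffun 'I_n -> R}}) : Prop :=
  generating_set M B /\
  forall B' : {set {ffun 'I_n -> R}}, generating_set M B' -> (#|B| <= #|B'|)%N.

Definition flow_up_spline (R : finComNzRingType) n (E : {set {set 'I_n}})
    (alpha : {set 'I_n} -> {set R}) (i : 'I_n) (f : {ffun 'I_n -> R}) : Prop :=
  f \in splines E alpha /\ forall t : 'I_n, (t < i)%N -> f t = 0.

Definition flow_up_minimum_generating_set (R : finComNzRingType) n
    (E : {set {set 'I_n}}) (alpha : {set 'I_n} -> {set R})
    (B : {set {ffun 'I_n -> R}}) : Prop :=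
  minimum_generating_set (splines E alpha) B /\
  forall f, f \in B -> exists i, flow_up_spline E alpha i f.

Definition zero_connected (R : finComNzRingType) n (E : {set {set 'I_n}})
    (alpha : {set 'I_n} -> {set R}) : rel 'I_n :=
  connect [rel x y | ([set x; y] \in E) && (alpha [set x; y] == [set 0])].

(* zero_component E alpha i is the class V^(i) when i is its smallest vertex,
   that is, when i is in min_indices E alpha. *)
Definition zero_component (R : finComNzRingType) n (E : {set {set 'I_n}})
    (alpha : {set 'I_n} -> {set R}) (i : 'I_n) : {set 'I_n} :=
  [set w | zero_connected E alpha i w].

Definition min_indices (R : finComNzRingType) n (E : {set {set 'I_n}})
    (alpha : {set 'I_n} -> {set R}) : {set 'I_n} :=
  [set i | [forall w in zero_component E alpha i, (i <= w)%N]].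

(* 'Z_(p ^ b) is Z/p^b only when p ^ b > 1; the level b = 0 is never used. *)
Definition rho (p k b : nat) (x : 'Z_(p ^ k)) : 'Z_(p ^ b) := (x : nat)%:R.

Definition labels_mod (p k n : nat) (alpha : {set 'I_n} -> {set 'Z_(p ^ k)})
    (b : nat) (e : {set 'I_n}) : {set 'Z_(p ^ b)} :=
  @rho p k b @: alpha e.

Definition bvec (p k n : nat) (E : {set {set 'I_n}})
    (alpha : {set 'I_n} -> {set 'Z_(p ^ k)}) (b : nat) (i : 'I_n) :
    {ffun 'I_n -> 'Z_(p ^ b)} :=
  [ffun w => if w \in zero_component E (labels_mod alpha b) i
             then (p ^ b.-1)%:R else 0].

(* An element of 'Z_(p ^ b) is stored as its least nonnegative
   representative, which is read again modulo p ^ b.+1. *)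
Definition lift_label (p n b : nat) (f : {ffun 'I_n -> 'Z_(p ^ b)}) :
    {ffun 'I_n -> 'Z_(p ^ b.+1)} :=
  [ffun w => (f w : nat)%:R].

(* The sets B_(p^b) for b >= 1; the value at b = 0 is a placeholder. *)
Fixpoint BB (p k n : nat) (E : {set {set 'I_n}})
    (alpha : {set 'I_n} -> {set 'Z_(p ^ k)}) (b : nat) :
    {set {ffun 'I_n -> 'Z_(p ^ b)}} :=
  match b with
  | 0 => set0
  | c.+1 =>
    match c with
    | 0 => [set bvec E alpha c.+1 i | i in min_indices E (labels_mod alpha c.+1)]
    | _.+1 =>
      (@lift_label p n c @: BB E alpha c) :|:
      [set bvec E alpha c.+1 i |
        i in min_indices E (labels_mod alpha c.+1) :\:
             min_indices E (labels_mod alpha c)]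
    end
  end.

(* Main.v *)
Require Import Defs.
From mathcomp Require Import all_boot all_order all_algebra.
Set Implicit Arguments.
Unset Strict Implicit.
Unset Printing Implicit Defensive.
Import GRing.Theory.
Local Open Scope ring_scope.

(* The elements of [BB b] are the integer vectors [p^c] times the indicator of
   [V^(i,c+1)], where [c+1] is the first level at which [v_i] is the smallest
   vertex of its zero-connected component.  If a spline [f] vanishes before
   [v_m] then [p^c] divides [f m] for the [c] of [m]: when [c > 0], some earlier
   vertex is zero-connected to [v_m] at level [c], so [f m] is zero modulo
   [p^c].  Hence flow-up elimination proves generation.
   For minimality, a module [M] over [Z/p^b] with [m] generators satisfies
   [#|M[p]| = #|M / p M| <= p^m], while the [p]-torsion of the splines contains
   the multiples by [p^(b-1)] of all labelings that are constant on the
   zero-connected components, so it has at least [p ^ #|I_b| >= p ^ #|BB b|]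
   elements. *)

(** * Ideals given as sets *)

Section Ideals.

Variables (R : finComNzRingType) (I : {set R}).
Hypothesis idealI : is_ideal I.

Lemma ideal_mull a x : x \in I -> a * x \in I.
Proof. by case: idealI => I0 IP xI; rewrite -[a * x]addr0 IP. Qed.

Lemma ideal_opp x : x \in I -> - x \in I.
Proof. by rewrite -mulN1r; apply: ideal_mull. Qed.

End Ideals.

(** * Splines and zero-connected components over a finite commutative ring *)

Section Splines.

Variables (R : finComNzRingType) (n : nat) (E : {set {set 'I_n}}).
Variable alpha : {set 'I_n} -> {set R}.

Lemma splineP (f : {ffun 'I_n -> R}) :
  reflect (forall u v, [set u; v] \in E -> f u - f v \in alpha [set u; v])
          (f \in splines E alpha).
Proof.
rewrite inE; apply: (iffP forallP) => [H u v uvE | H u].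
  by have /forallP/(_ v)/implyP/(_ uvE) := H u.
by apply/forallP => v; apply/implyP => /H.
Qed.

Lemma zero_connected_sym : symmetric (zero_connected E alpha).
Proof. by apply: sym_connect_sym => x y /=; rewrite setUC. Qed.

Lemma zero_component_edge i u v :
  [set u; v] \in E -> alpha [set u; v] = [set 0] ->
  (u \in zero_component E alpha i) = (v \in zero_component E alpha i).
Proof.
move=> uvE uv0; rewrite !inE.
have uv : zero_connected E alpha u v by apply: connect1; rewrite /= uvE uv0 eqxx.
apply/idP/idP => iw; apply: connect_trans iw _ => //.
by rewrite -/(zero_connected _ _ _ _) zero_connected_sym.
Qed.

Lemma zero_component_refl i : i \in zero_component E alpha i.
Proof. by rewrite inE; apply: connect0. Qed.

Lemma min_indices_le i w :
  i \in min_indices E alpha -> w \in zero_component E alpha i -> (i <= w)%N.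
Proof. by rewrite inE => /forallP/(_ w)/implyP. Qed.

Lemma min_indices_inj i j :
  i \in min_indices E alpha -> j \in min_indices E alpha ->
  j \in zero_component E alpha i -> i = j.
Proof.
move=> iI jI ij; apply/val_inj/eqP; rewrite eqn_leq (min_indices_le iI ij).
by rewrite (min_indices_le jI) // inE zero_connected_sym; rewrite inE in ij.
Qed.

(** Consecutive values of a spline along a path of zero-labelled edges differ by an element of the
    zero ideal. *)
Lemma spline_zero_component f i w :
  f \in splines E alpha -> w \in zero_component E alpha i -> f w = f i.
Proof.
move=> /splineP fM; rewrite inE => /connectP[s + ->] {w}.
elim: s i => //= x s IHs i /andP[/andP[ixE /eqP ix0]] /IHs ->.
by have := fM _ _ ixE; rewrite ix0 inE subr_eq0 => /eqP.
Qed.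

(** The component of [m] contains an earlier vertex, where [f] vanishes, and [f] is constant on that
    component. *)
Lemma spline_nonmin f (m : 'I_n) :
  f \in splines E alpha -> (forall t : 'I_n, (t < m)%N -> f t = 0) ->
  m \notin min_indices E alpha -> f m = 0.
Proof.
move=> fM f0; rewrite inE negb_forall => /existsP[w].
rewrite negb_imply -ltnNge => /andP[mw wm].
by rewrite -(spline_zero_component fM mw) f0.
Qed.

Hypothesis alpha_ideals : ideal_labeling E alpha.

Lemma spline0 : 0 \in splines E alpha.
Proof.
by apply/splineP => u v /alpha_ideals[I0 _]; rewrite !ffunE subr0.
Qed.

Lemma spline_lin a f g : f \in splines E alpha -> g \in splines E alpha ->
  [ffun w => a * f w] + g \in splines E alpha.
Proof.
move=> /splineP fM /splineP gM; apply/splineP => u v uvE.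
have [_ IP] := alpha_ideals uvE; rewrite !ffunE opprD addrACA -mulrBr.
by rewrite IP ?fM ?gM.
Qed.

End Splines.

(** * Torsion bound for generating sets *)

(* Both bounds compare with [#|M|]: the fibres of [f |-> a f] on [M] are cosets
   of the [a]-torsion of [M], and [M / a M] has at most [#|S| ^ #|B|] elements. *)
Lemma card_torsion_le (R : finComNzRingType) n (M B : {set {ffun 'I_n -> R}})
    (a : R) (S : {set R}) :
  (forall x f g, f \in M -> g \in M -> [ffun w => x * f w] + g \in M) ->
  0 \in M -> generating_set M B ->
  (forall x : R, exists2 r, r \in S & exists d, x = r + a * d) ->
  (#|[set f in M | ([ffun w => a * f w] == 0)%R]| <= #|S| ^ #|B|)%N.
Proof.
move=> Mlin M0 [/subsetP BM genB] Sa.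
pose mul x (f : {ffun 'I_n -> R}) : {ffun 'I_n -> R} := [ffun w => x * f w].
have mulM x f : f \in M -> mul x f \in M.
  by move=> fM; rewrite -[mul x f]addr0 Mlin.
have addM f g : f \in M -> g \in M -> f + g \in M.
  move=> fM gM; suff -> : f = mul 1 f by apply: Mlin.
  by apply/ffunP => w; rewrite ffunE mul1r.
set T := [set f in M | _]; pose aM := mul a @: M.
have aM0 : (0 < #|aM|)%N 
  by rewrite card_gt0; apply/set0Pn; exists (mul a 0); apply: imset_f.
rewrite -(leq_pmul2r aM0); apply: (@leq_trans #|M|).
  (* [s] picks a preimage in [M] under multiplication by [a]; then [(t, h) |-> t + s h] embeds the
     product of [T] and [aM] into [M]. *)
  pose s h : {ffun 'I_n -> R} := odflt 0 [pick f in M | mul a f == h].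
  have sP h : h \in aM -> s h \in M /\ mul a (s h) = h.
    move=> /imsetP[f fM ->]; rewrite /s; case: pickP => [g /andP[gM /eqP] //|].
    by move/(_ f); rewrite fM eqxx.
  rewrite -cardsX -(@card_in_imset _ _
    (fun th : {ffun 'I_n -> R} * {ffun 'I_n -> R} => th.1 + s th.2)).
    apply/subset_leq_card/subsetP => _ /imsetP[[t h] /setXP[/= tT hM] ->].
    by apply: addM; [move: tT; rewrite inE => /andP[] | case: (sP h)].
  move=> [t h] [t' h'] /setXP[/= tT hM] /setXP[/= t'T hM'] eq_th.
  have eqm x u : u \in T -> x \in aM -> mul a (u + s x) = x.
    rewrite inE => /andP[_ /eqP u0] /sP[_ sx]; rewrite -[RHS]sx; apply/ffunP => w.
    by move/ffunP/(_ w): u0; rewrite !ffunE mulrDr => ->; rewrite add0r.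
  have hh' : h = h' by rewrite -(eqm h t) // eq_th eqm.
  by rewrite hh' in eq_th *; rewrite (addIr _ eq_th).
(* Coefficient systems with values in [S] on [B] and 0 off [B]. Writing each coefficient as
   [r + a * d] gives [f = comb r + a * comb d], so [D] and [aM] together cover [M]. *)
pose D : {set {ffun {ffun 'I_n -> R} -> R}} :=
  [set x in pffun_on 0 (mem B) (mem S)].
have cardD : #|D| = (#|S| ^ #|B|)%N by rewrite cardsE card_pffun_on.
rewrite -cardD -cardsX.
pose comb (x : {ffun 'I_n -> R} -> R) : {ffun 'I_n -> R} :=
  [ffun u => \sum_(b in B) x b * b u].
have combM x : comb x \in M.
  have -> : comb x = \sum_(b in B) mul (x b) b.
    by apply/ffunP => u; rewrite sum_ffunE ffunE; apply: eq_bigr => b _; rewrite ffunE.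
  by apply: (big_ind (fun g => g \in M)) => // b bB; apply/mulM/BM.
apply: leq_trans (leq_imset_card
  (fun xh : {ffun _ -> R} * {ffun 'I_n -> R} => comb xh.1 + xh.2) _).
apply/subset_leq_card/subsetP => f /genB[c fE].
have [r rS rP] := fin_all_exists2 (fun b => Sa (c b)).
have [d dP] := fin_all_exists rP.
apply/imsetP; exists ([ffun b => if b \in B then r b else 0], mul a (comb d)).
  apply/setXP; split; last exact: imset_f.
  rewrite inE; apply/pffun_onP; split=> [|_ /imageP[b bB ->]].
    by apply/subsetP => b; rewrite inE ffunE; case: ifP => //; rewrite eqxx.
  by rewrite ffunE bB; apply: rS.
apply/ffunP => u; rewrite fE !ffunE mulr_sumr -big_split /=.
by apply: eq_bigr => b bB; rewrite ffunE bB mulrA -mulrDl -dP.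
Qed.

(** * Reduction maps and ideals modulo prime powers *)

Section PrimePowers.

Variables (p : nat).
Hypothesis p_prime : prime p.

Lemma pexp_gt1 b : (0 < b)%N -> (1 < p ^ b)%N.
Proof. by move=> b0; rewrite -(expn0 p) ltn_exp2l ?prime_gt1. Qed.

Lemma val_natr_pexp b m : (0 < b)%N -> (m%:R : 'Z_(p ^ b)) = (m %% p ^ b)%N :> nat.
Proof. by move=> /pexp_gt1 b1; rewrite val_Zp_nat. Qed.

Lemma natr_pexp_eq0 b m : (0 < b)%N -> ((m%:R : 'Z_(p ^ b)) == 0) = (p ^ b %| m)%N.
Proof. by move=> b0; rewrite -val_eqE /= val_natr_pexp. Qed.

Lemma rho_natr c b m : (0 < b <= c)%N -> rho b (m%:R : 'Z_(p ^ c)) = m%:R.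
Proof.
move=> /andP[b0 bc]; apply: val_inj; rewrite /rho /= !val_natr_pexp //.
  by rewrite modn_dvdm ?dvdn_exp2l.
exact: leq_trans bc.
Qed.

Lemma rhoD c b : (0 < b <= c)%N -> {morph @rho p c b : x y / x + y}.
Proof.
by move=> bc x y; rewrite -[x]natr_Zp -[y]natr_Zp -natrD !rho_natr // natrD.
Qed.

Lemma rhoM c b : (0 < b <= c)%N -> {morph @rho p c b : x y / x * y}.
Proof.
by move=> bc x y; rewrite -[x]natr_Zp -[y]natr_Zp -natrM !rho_natr // natrM.
Qed.

Lemma rhoB c b : (0 < b <= c)%N -> {morph @rho p c b : x y / x - y}.
Proof. by move=> bc x y; apply/eqP; rewrite eq_sym subr_eq -rhoD // subrK. Qed.

Lemma rho_comp c b a (x : 'Z_(p ^ c)) :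
  (0 < a <= b)%N -> rho a (rho b x) = rho a x.
Proof. by move=> ab; rewrite {1}[rho b x]/rho rho_natr. Qed.

(* The ideal of [Z/p^c] generated by [y] is generated by [gcd (y, p^c)]. *)
Lemma ideal_pexp c (I : {set 'Z_(p ^ c)}) b (y : 'Z_(p ^ c)) : is_ideal I ->
  (0 < c)%N -> y \in I -> ~~ (p ^ b.+1 %| y)%N -> (p ^ b)%:R \in I.
Proof.
move=> idI c0 yI ndvd; have pc0 : (0 < p ^ c)%N by rewrite expn_gt0 prime_gt0.
have [a _ dvd] := Bezoutl y pc0.
have /(dvdn_pfactor _ _ p_prime)[s _ gs] := dvdn_gcdl (p ^ c) y.
have sb : (s <= b)%N.
  rewrite leqNgt; apply: contra ndvd => bs.
  by apply: dvdn_trans (dvdn_exp2l p bs) _; rewrite -gs dvdn_gcdr.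
rewrite -(subnK sb) expnD natrM; apply: ideal_mull => //.
(* Bezout modulo [p ^ c]: the gcd [p ^ s] equals [- a * y], a multiple of [y]. *)
move: dvd; rewrite gs -natr_pexp_eq0 // natrD natrM natr_Zp addr_eq0 => /eqP ->.
by rewrite -mulNr; apply: ideal_mull.
Qed.

(** * Labels, components and splines at different levels *)

Variables (k n : nat) (E : {set {set 'I_n}}).
Variable alpha : {set 'I_n} -> {set 'Z_(p ^ k)}.
Hypothesis alpha_ideals : ideal_labeling E alpha.

Lemma labels_mod_ideal b : (0 < b <= k)%N -> ideal_labeling E (labels_mod alpha b).
Proof.
move=> bk e /alpha_ideals[I0 IP]; split=> [|a _ _ /imsetP[x xI ->] /imsetP[y yI ->]].
  by apply/imsetP; exists 0.
(* The image ideal absorbs [a] because [a] lifts to a scalar of [Z/p^k]. *)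
have -> : a = rho b ((a : nat)%:R : 'Z_(p ^ k)) by rewrite rho_natr // natr_Zp.
by rewrite -rhoM // -rhoD //; apply/imset_f/IP.
Qed.

Lemma labels_mod_rho b c e : (0 < c <= b)%N ->
  labels_mod alpha c e = @rho p b c @: labels_mod alpha b e.
Proof.
by move=> cb; rewrite -imset_comp; apply: eq_imset => x /=; rewrite rho_comp.
Qed.

(** This permits a jump of [p ^ c] across an edge leaving a component of level [c.+1]: a nonzero
    label there comes from some [y] in [alpha e] not divisible by [p ^ c.+1], so [alpha e] already
    contains [p ^ c]. *)
Lemma pexp_labels_mod b c e : (0 < b <= k)%N -> (c < k)%N -> e \in E ->
  labels_mod alpha c.+1 e != [set 0] -> (p ^ c)%:R \in labels_mod alpha b e.
Proof.
move=> bk ck /alpha_ideals idI /eqP nz.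
have [y yI ndvd] : exists2 y, y \in alpha e & ~~ (p ^ c.+1 %| y)%N.
  apply/exists_inP; apply: contra_notT nz; rewrite negb_exists_in => /forall_inP dvd.
  apply/setP => z; rewrite inE; apply/imsetP/eqP => [[y /dvd]|->].
    by rewrite negbK -natr_pexp_eq0 // => /eqP y0 ->.
  by exists 0; first by case: idI.
by rewrite -(rho_natr _ bk); apply/imset_f/(ideal_pexp idI _ yI ndvd)/leq_ltn_trans/ck.
Qed.

Lemma labels_mod_eq0 b c e : (0 < c <= b)%N ->
  labels_mod alpha b e = [set 0] -> labels_mod alpha c e = [set 0].
Proof.
by move=> cb b0; rewrite (labels_mod_rho _ cb) b0 imset_set1.
Qed.

Lemma zero_component_mod b c i : (0 < c <= b)%N ->
  zero_component E (labels_mod alpha b) i \subset zero_component E (labels_mod alpha c) i.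
Proof.
move=> cb; apply/subsetP => w; rewrite !inE; apply: connect_sub => x y /=.
case/andP=> xyE /eqP xy0; apply: connect1 => /=.
by rewrite xyE (labels_mod_eq0 cb xy0) eqxx.
Qed.

(** Components shrink as the level rises, and the smallest vertex of a set stays smallest in any
    subset containing it. *)
Lemma min_indices_mod b c : (0 < c <= b)%N ->
  min_indices E (labels_mod alpha c) \subset min_indices E (labels_mod alpha b).
Proof.
move=> cb; apply/subsetP => i iI; rewrite inE; apply/forall_inP => w.
by move/(subsetP (zero_component_mod _ cb)); apply: min_indices_le.
Qed.

Lemma spline_rho b c f : (0 < c <= b)%N ->
  f \in splines E (labels_mod alpha b) ->
  [ffun w => rho c (f w)] \in splines E (labels_mod alpha c).
Proof.
move=> cb /splineP fM; apply/splineP => u v uvE.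
by rewrite !ffunE -rhoB // (labels_mod_rho _ cb) imset_f ?fM.
Qed.

(** * Explicit form and size of the sets [BB] *)

(* The image of [bvec c.+1 i] under [b - c.+1] applications of [lift_label]. *)
Definition lifted_bvec (c b : nat) (i : 'I_n) : {ffun 'I_n -> 'Z_(p ^ b)} :=
  [ffun w => if w \in zero_component E (labels_mod alpha c.+1) i
             then (p ^ c)%:R else 0].

(** Since [p ^ c < p ^ b], the entry [p ^ c] is its own least representative. *)
Lemma lift_lifted_bvec c b i : (c < b)%N ->
  lift_label (lifted_bvec c b i) = lifted_bvec c b.+1 i.
Proof.
move=> cb; apply/ffunP => w; rewrite !ffunE; case: ifP => // _.
by rewrite val_natr_pexp ?modn_small ?ltn_exp2l ?prime_gt1 //; case: b cb.
Qed.

(** Unfolds the recursion: [c.+1] is the level at which the vector enters. The guard [0 < c] is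
    there because the first level has no predecessor. *)
Lemma BB_P b f : reflect
  (exists c i, [/\ (c <= b)%N, i \in min_indices E (labels_mod alpha c.+1),
     (0 < c)%N -> i \notin min_indices E (labels_mod alpha c) &
     f = lifted_bvec c b.+1 i])
  (f \in BB E alpha b.+1).
Proof.
elim: b f => [|b IHb] f.
  apply: (iffP imsetP) => [[i iI ->]|[[|c] [i [//]]] _ iI _ ->]; last by exists i.
  by exists 0, i.
rewrite [BB _ _ _]/= -/(BB E alpha b.+1) inE; apply: (iffP orP).
  case=> /imsetP => [[g /IHb[c [i [cb iI ic ->]]]] ->|[i]].
    by exists c, i; split; rewrite ?lift_lifted_bvec // ltnW.
  by rewrite inE => /andP[ib iI] ->; exists b.+1, i.
move=> [c [i [cb iI ic ->]]]; move: cb; rewrite leq_eqVlt => /orP[/eqP cb|cb].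
  right; rewrite cb in iI ic *.
  by apply/imsetP; exists i => //; rewrite inE iI ic.
left; apply/imsetP; exists (lifted_bvec c b.+1 i); last by rewrite lift_lifted_bvec.
by apply/IHb; exists c, i.
Qed.

(** Each level adds at most one vector per new index, and the old indices remain. *)
Lemma card_BB b : (#|BB E alpha b.+1| <= #|min_indices E (labels_mod alpha b.+1)|)%N.
Proof.
elim: b => [|b IHb]; first exact: leq_imset_card.
rewrite [BB _ _ _]/= -/(BB E alpha b.+1).
apply: leq_trans (leq_card_setU _ _) _.
have sub : min_indices E (labels_mod alpha b.+1) \subset
           min_indices E (labels_mod alpha b.+2).
  by apply: min_indices_mod; rewrite /= leqnSn.
rewrite -[leqRHS](cardsID (min_indices E (labels_mod alpha b.+1))).
apply: leq_add; last exact: leq_imset_card.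
by rewrite (setIidPr sub); apply: leq_trans (leq_imset_card _ _) IHb.
Qed.

(** * Flow-up property and generation *)

Lemma lifted_bvec_spline b c i : (c < b <= k)%N ->
  lifted_bvec c b i \in splines E (labels_mod alpha b).
Proof.
move=> /andP[cb bk]; have b0 : (0 < b <= k)%N by rewrite bk (leq_ltn_trans _ cb).
apply/splineP => u v uvE; rewrite !ffunE.
have idl := labels_mod_ideal b0 uvE.
(* If the label vanishes at level [c.+1], both ends lie in the same component; otherwise the level
   [b] label contains [p ^ c]. *)
have [uv0|nz] := eqVneq (labels_mod alpha c.+1 [set u; v]) [set 0].
  by rewrite (zero_component_edge _ uvE uv0) subrr; case: idl.
have ck := leq_trans cb bk.
have pcI := pexp_labels_mod b0 ck uvE nz.
case: ifP => _; case: ifP => _; rewrite ?subrr ?subr0 ?sub0r //.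
- by case: idl.
- exact: ideal_opp.
- by case: idl.
Qed.

Lemma lifted_bvec_flow_up b c i : i \in min_indices E (labels_mod alpha c.+1) ->
  forall t : 'I_n, (t < i)%N -> lifted_bvec c b i t = 0.
Proof.
move=> iI t ti; rewrite ffunE; case: ifP => // /(min_indices_le iI).
by rewrite leqNgt ti.
Qed.

Lemma BB_flow_up b f : (b < k)%N -> f \in BB E alpha b.+1 ->
  exists i, flow_up_spline E (labels_mod alpha b.+1) i f.
Proof.
move=> bk /BB_P[c [i [cb iI _ ->]]]; exists i; split.
  by apply: lifted_bvec_spline; rewrite ltnS cb.
exact: lifted_bvec_flow_up.
Qed.

(** Supplies the elimination step: the leading entry of [f] is a multiple of the leading entry of
    some element of [BB]. *)
Lemma BB_pivot b f (m : 'I_n) : f \in splines E (labels_mod alpha b.+1) ->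
  (forall t : 'I_n, (t < m)%N -> f t = 0) -> f m != 0 ->
  exists2 g, g \in BB E alpha b.+1 &
    (forall t : 'I_n, (t < m)%N -> g t = 0) /\ exists a, f m = a * g m.
Proof.
move=> fM f0 fm; have mb : m \in min_indices E (labels_mod alpha b.+1).
  by apply: contraNT fm => /(spline_nonmin fM f0) ->.
have [c mc cmin] := ex_minnP (ex_intro
  (fun c => m \in min_indices E (labels_mod alpha c.+1)) b mb).
have cb := cmin _ mb; exists (lifted_bvec c b.+1 m).
  apply/BB_P; exists c, m; split=> //; case: {mc cb} c cmin => // c cmin _.
  by apply/negP => /cmin; rewrite ltnn.
split; first exact: lifted_bvec_flow_up.
rewrite ffunE zero_component_refl.
suff /dvdnP[q fq] : (p ^ c %| f m)%N by exists q%:R; rewrite -natrM -fq natr_Zp.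
case: c mc cmin cb => [|c] _ cmin cb; first exact: dvd1n.
have cb' : (0 < c.+1 <= b.+1)%N := leqW cb.
have mc : m \notin min_indices E (labels_mod alpha c.+1).
  by apply/negP => /cmin; rewrite ltnn.
(* The reduction of [f] modulo [p ^ c.+1] is a spline vanishing before [m], and [m] is not minimal
   at that level. *)
have := spline_nonmin (spline_rho cb' fM) _ mc; rewrite ffunE => rho0.
rewrite -natr_pexp_eq0 //; apply/eqP/rho0 => t /f0; rewrite ffunE => ->.
by rewrite -(mulr0n 1) rho_natr.
Qed.

Lemma BB_generating b : (b < k)%N ->
  generating_set (splines E (labels_mod alpha b.+1)) (BB E alpha b.+1).
Proof.
move=> bk; split; first by apply/subsetP => f /(BB_flow_up bk)[i []].
(* Induction on the number [d] of final vertices at which [f] may be nonzero. *)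
suff gen d (f : {ffun 'I_n -> 'Z_(p ^ b.+1)}) :
    (d <= n)%N -> (forall t : 'I_n, (t < n - d)%N -> f t = 0) ->
    f \in splines E (labels_mod alpha b.+1) ->
    exists c : {ffun 'I_n -> 'Z_(p ^ b.+1)} -> 'Z_(p ^ b.+1),
      forall u, f u = \sum_(g in BB E alpha b.+1) c g * g u.
  by move=> f; apply: (gen n) => // t; rewrite subnn.
elim: d f => [|d IHd] f dn f0 fM.
  exists (fun=> 0) => u; rewrite big1 => [|? _]; last exact: mul0r.
  by rewrite f0 // subn0.
have mn : (n - d.+1 < n)%N by rewrite ltn_subrL (leq_ltn_trans _ dn).
pose m := Ordinal mn.
have step t : (t < n - d)%N -> (t <= n - d.+1)%N by rewrite subnS; case: (n - d)%N.
have [fm|fm] := eqVneq (f m) 0.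
  apply: IHd => // [|t /step]; first exact: ltnW.
  by rewrite leq_eqVlt => /orP[/eqP tm|/f0 //]; rewrite -fm; congr (f _); apply: val_inj.
have [g gB [g0 [a fa]]] := BB_pivot (m := m) fM f0 fm.
have gM : g \in splines E (labels_mod alpha b.+1) by have [i []] := BB_flow_up bk gB.
have [|||c cP] := IHd ([ffun w => - a * g w] + f); first exact: ltnW.
- move=> t /step; rewrite leq_eqVlt => /orP[/eqP tm|tm].
    have -> : t = m by apply: val_inj.
    by rewrite !ffunE fa mulNr addNr.
  by rewrite !ffunE f0 // g0 // mulr0 addr0.
- by apply: spline_lin => //; apply: labels_mod_ideal.
(* The multiple of [g] subtracted from [f] goes back into the coefficient of [g]. *)
exists (fun h => c h + (if h == g then a else 0)) => u.
under eq_bigr do rewrite mulrDl.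
rewrite big_split /= -cP !ffunE (bigD1 g) //= eqxx big1 => [|h /andP[_ /negPf ->]].
  by rewrite addr0 mulNr addrC addNKr.
exact: mul0r.
Qed.

(** * Lower bound on the size of a generating set *)

Lemma card_torsion_splines b : (b < k)%N ->
  (p ^ #|min_indices E (labels_mod alpha b.+1)| <=
   #|[set f in splines E (labels_mod alpha b.+1) |
       ([ffun w => p%:R * f w] == 0)%R]|)%N.
Proof.
move=> bk; set I := min_indices _ _; set T := [set f in _ | _].
have idl := labels_mod_ideal (bk : 0 < b.+1 <= k)%N.
pose F (x : {ffun 'I_n -> 'I_p}) : {ffun 'I_n -> 'Z_(p ^ b.+1)} :=
  [ffun w => \sum_(i in I) (x i : nat)%:R * lifted_bvec b b.+1 i w].
have p0 := prime_gt0 p_prime.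
(* Digit vectors supported on [I]; forcing the digit 0 off [I] makes their number [p ^ #|I|]. *)
pose D : {set {ffun 'I_n -> 'I_p}} :=
  [set x in pffun_on (Ordinal p0) (mem I) predT].
have -> : (p ^ #|I|)%N = #|D| by rewrite [RHS]cardsE card_pffun_on card_ord.
(* Only the component of [j] itself contributes at [j], and [x j * p ^ b < p ^ b.+1] does not wrap
   around, so [F x] determines the digits of [x]. *)
have Fj (x : {ffun 'I_n -> 'I_p}) j : j \in I -> (F x j : nat) = (x j * p ^ b)%N.
  move=> jI; suff -> : F x j = (x j * p ^ b)%:R.
    rewrite val_natr_pexp // modn_small //.
    by rewrite expnS ltn_pmul2r ?expn_gt0 ?p0.
  rewrite ffunE (bigD1 j) //= big1 => [|i /andP[iI ij]]; last first.
    rewrite ffunE; case: ifP => [|_]; last exact: mulr0.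
    by move/(min_indices_inj iI jI)/eqP; rewrite (negPf ij).
  by rewrite addr0 ffunE zero_component_refl -natrM.
rewrite -(@card_in_imset _ _ F) => [|x y]; last first.
  rewrite !inE => /pffun_onP[/subsetP xI _] /pffun_onP[/subsetP yI _] xy.
  apply/ffunP => j; have [jI|jI] := boolP (j \in I).
    apply: val_inj; have := Fj x j jI; rewrite xy Fj // => /eqP.
    by rewrite eqn_pmul2r ?expn_gt0 ?p0 // => /eqP.
  have out z : {subset (Ordinal p0).-support z <= mem I} -> z j = Ordinal p0.
    by move=> zI; apply/eqP; apply: contraNT jI => /zI.
  by rewrite !out.
apply/subset_leq_card/subsetP => _ /imsetP[x _ ->]; rewrite inE; apply/andP; split.
  have -> : F x = \sum_(i in I) [ffun w => (x i : nat)%:R * lifted_bvec b b.+1 i w].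
    by apply/ffunP => w; rewrite sum_ffunE [LHS]ffunE; apply: eq_bigr => i _;
       rewrite [RHS]ffunE.
  apply: (big_ind (fun g => g \in _)) => [|f g fM gM|i iI]; first exact: spline0.
    suff -> : f = [ffun w => 1 * f w] by apply: spline_lin.
    by apply/ffunP => w; rewrite ffunE mul1r.
  rewrite -[X in X \in _]addr0; apply: spline_lin; first by [].
    by apply: lifted_bvec_spline; rewrite leqnn.
  exact: spline0.
apply/eqP/ffunP => w; rewrite !ffunE mulr_sumr big1 // => i _.
rewrite ffunE; case: ifP => _; last by rewrite !mulr0.
(* Here [p * p ^ b = p ^ b.+1] is zero in [Z/p^(b+1)]. *)
by rewrite mulrCA -natrM -expnS -[X in _ * X]natr_Zp val_natr_pexp // modnn mulr0.
Qed.

Lemma card_generating_set b B : (b < k)%N ->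
  generating_set (splines E (labels_mod alpha b.+1)) B ->
  (#|min_indices E (labels_mod alpha b.+1)| <= #|B|)%N.
Proof.
move=> bk genB; have idl := labels_mod_ideal (bk : 0 < b.+1 <= k)%N.
pose S : {set 'Z_(p ^ b.+1)} := [set (r : nat)%:R | r : 'I_p].
have cardS : (#|S| <= p)%N by apply: leq_trans (leq_imset_card _ _) _; rewrite card_ord.
rewrite -(leq_exp2l _ _ (prime_gt1 p_prime)).
apply: leq_trans (card_torsion_splines bk) _.
apply: (@leq_trans (#|S| ^ #|B|)); last first.
  by case: (#|B|) => // m; rewrite leq_exp2r.
apply: card_torsion_le genB _ => [x f g fM gM||x].
- exact: spline_lin.
- exact: spline0.
(* Euclidean division by [p] represents every class modulo [p] in [S]. *)
exists ((x %% p)%N)%:R; last first.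
  exists ((x %/ p)%N)%:R.
  by rewrite -natrM -natrD mulnC addnC -divn_eq natr_Zp.
by apply/imsetP; exists (Ordinal (ltn_pmod x (prime_gt0 p_prime))).
Qed.

End PrimePowers.

Theorem theorem3p11 (p k n : nat) (E : {set {set 'I_n}})
    (alpha : {set 'I_n} -> {set 'Z_(p ^ k)})
    (p_prime : prime p) (k_ge1 : (1 <= k)%N)
    (G_simple : simple_graph E) (G_connected : connected_graph E)
    (alpha_ideals : ideal_labeling E alpha) :
  forall b : nat, (1 <= b <= k)%N ->
    flow_up_minimum_generating_set E (labels_mod alpha b) (BB E alpha b).
Proof.
move=> [//|b] /= bk; split; last by move=> f; apply: BB_flow_up.
split; first exact: BB_generating.
move=> B genB; apply: leq_trans (card_BB _ _ _ _) _ => //.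
exact: card_generating_set genB.
Qed.
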